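(* Let $p\geq 2$ and let $\mathcal{U}=\{u_1,\dots,u_p\}\subset\mathbb{R}^3$ be a set of $p$ pairwise linearly independent elements. Then $\mathcal{U}$ can be isometrically embedded in $\mathbb{R}^3_{\geq 0}$ if and only if this can be done with two of its elements having the same coordinate equal to zero; that is, there is an orthogonal matrix $Q$ with $Q\,\mathcal{U}\subset\mathbb{R}^3_{\geq 0}$ if and only if there are an orthogonal matrix $Q$ with $Q\,\mathcal{U}\subset\mathbb{R}^3_{\geq 0}$, indices $i\neq j$ in $\{1,\dots,p\}$ and a coordinate index $k\in\{1,2,3\}$ such that $(Qu_i)_k=(Qu_j)_k=0$.
   Context: $\mathbb{R}^3_{\geq 0}$ is the set of vectors in $\mathbb{R}^3$ with all coordinates nonnegative. A set $\mathcal{U}\subset\mathbb{R}^3$ can be isometrically embedded in $\mathbb{R}^3_{\geq 0}$ if there is an orthogonal matrix $Q\in\mathbb{R}^{3\times 3}$ with $Q\,\mathcal{U}\subset\mathbb{R}^3_{\geq 0}$. *)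

(* Defs.v *)
From HB Require Import structures.
From mathcomp Require Import all_boot all_order all_algebra.
From mathcomp Require Import boolp classical_sets reals.

Set Implicit Arguments.
Unset Strict Implicit.
Unset Printing Implicit Defensive.

Import Order.TTheory GRing.Theory Num.Theory.

Local Open Scope classical_set_scope.
Local Open Scope ring_scope.

Definition orthogonal_mx (R : realType) (n : nat) (Q : 'M[R]_n) : Prop :=
  Q^T *m Q = 1%:M.

Definition nonneg_orthant (R : realType) (n : nat) : set 'cV[R]_n :=
  [set x | forall k : 'I_n, 0 <= x k ord0].

Definition embeds_by (R : realType) (n : nat) (Q : 'M[R]_n)
    (U : set 'cV[R]_n) : Prop :=
  orthogonal_mx Q /\ [set Q *m x | x in U] `<=` @nonneg_orthant R n.

Definition isometrically_embeddable (R : realType) (n : nat)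
    (U : set 'cV[R]_n) : Prop :=
  exists Q : 'M[R]_n, embeds_by Q U.

Definition pairwise_lin_indep (R : realType) (n p : nat)
    (u : 'I_p -> 'cV[R]_n) : Prop :=
  forall i j : 'I_p, i != j -> free [:: u i; u j].

(* Main.v *)
Require Import Defs.
From HB Require Import structures.
From mathcomp Require Import all_boot all_order all_algebra.
From mathcomp Require Import boolp classical_sets reals.
From mathcomp Require Import filter topology normedtype derive.
From mathcomp Require Import ring lra.

Set Implicit Arguments.
Unset Strict Implicit.
Unset Printing Implicit Defensive.

Import Order.TTheory GRing.Theory Num.Theory.
Import numFieldNormedType.Exports.

Local Open Scope classical_set_scope.
Local Open Scope ring_scope.

(** The forward direction is the content.  Let [Q] carry the vectors into the
    orthant, with rows [x], [a], [b], and look at the vectors along [x]: their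
    projections to the plane of [a] and [b] lie in the quadrant, i.e. in a plane
    angle of at most a right angle.  Conversely, whenever [x] is nonnegative on
    all vectors and the projections along [x] fit into a right angle, [x]
    extends to an orthonormal frame with nonnegative coordinates.  So choose,
    among all frames, one for which this apparent angle is smallest.  In
    coordinates ([X], [Y], [Z]), the angle is cut out by [0 <= Z] and
    [tau Z <= Y] with [tau >= 0] its cotangent; writing the second condition as
    [mu Z <= (1 - mu) Y] with [0 <= mu <= 1] makes the set of pairs ([Q], [mu])
    compact, so a maximal [mu] exists ([exists_maximal_frame]).

    At a maximal frame, suppose that no frame puts two vectors on one coordinate
    plane.  Then exactly one vector [u_i] is on the side [Z = 0] of the angle,
    exactly one vector [u_j] on the side [Y = tau Z], because two on a side would
    share a zero coordinate with respect to the normal of that side; and at most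
    one vector [u_k] satisfies [X = 0].  Now move [x] to [x + t d], where [d] is
    orthogonal to [x] and to [u_k] (or to [u_i], if [X] vanishes nowhere).  For
    small [t], only the pair ([u_i], [u_j]) bounds the new angle.  For unit [x]
    and [d], its cotangent is a positive multiple of
      (1 + t^2) <u_i, u_j> - <x + t d, u_i> <x + t d, u_j>
    divided by [sqrt (1 + t^2)] times a determinant that is affine in [t].  When
    the gains for [t] and [- t] are added, the odd terms cancel and a positive
    multiple of [t^2] remains ([tilt]), so one of the two signs makes the angle
    strictly smaller, contradicting maximality.  The positive multiple degenerates
    only when the angle is right and [u_k] is [u_i] or [u_j], so that [u_k] lies
    on a coordinate axis; then turning the frame about that axis keeps two
    coordinates of [u_k] at zero, until a second vector reaches the plane
    [X = 0] ([escape]). *)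

(** * Coordinates and orthonormal frames in dimension three *)

Definition ix : 'I_3 := Ordinal (isT : (0 < 3)%N).
Definition iy : 'I_3 := Ordinal (isT : (1 < 3)%N).
Definition iz : 'I_3 := Ordinal (isT : (2 < 3)%N).

Lemma ord3_ind (P : 'I_3 -> Prop) : P ix -> P iy -> P iz -> forall k, P k.
Proof.
move=> Px Py Pz [[|[|[|n]]] lt_k] //.
- by rewrite (_ : Ordinal _ = ix) //; apply: val_inj.
- by rewrite (_ : Ordinal _ = iy) //; apply: val_inj.
- by rewrite (_ : Ordinal _ = iz) //; apply: val_inj.
Qed.

Lemma big_ord3 (R : nmodType) (F : 'I_3 -> R) :
  \sum_i F i = F ix + F iy + F iz.
Proof.
rewrite !big_ord_recl big_ord0 addr0 addrA.
by congr (F _ + F _ + F _); apply: val_inj.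
Qed.

Section Space.
Variable R : realType.
Implicit Types x y b v : R * R * R.

(** Vectors that describe a frame are plain triples: their products then unfold
    to scalar expressions on which [ring] and [lra] work directly. *)
Definition dot3 x y : R := x.1.1 * y.1.1 + x.1.2 * y.1.2 + x.2 * y.2.

Definition cross3 x y : R * R * R :=
  (x.1.2 * y.2 - x.2 * y.1.2, x.2 * y.1.1 - x.1.1 * y.2,
   x.1.1 * y.1.2 - x.1.2 * y.1.1).

Definition coords (w : 'cV[R]_3) : R * R * R :=
  (w ix ord0, w iy ord0, w iz ord0).

Definition rows_mx x y b : 'M[R]_3 :=
  \matrix_(i, j) let r := tnth [tuple x; y; b] i in
                 tnth [tuple r.1.1; r.1.2; r.2] j.

Lemma rows_mxM x y b (w : 'cV[R]_3) :
  coords (rows_mx x y b *m w) =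
  (dot3 x (coords w), dot3 y (coords w), dot3 b (coords w)).
Proof.
by rewrite /coords !mxE !big_ord3 !mxE.
Qed.

Lemma orthogonal_mxM (P Q : 'M[R]_3) :
  orthogonal_mx P -> orthogonal_mx Q -> orthogonal_mx (P *m Q).
Proof.
rewrite /orthogonal_mx => PP QQ.
by rewrite trmx_mul -mulmxA (mulmxA _ P) PP mul1mx.
Qed.

Lemma dot3C x y : dot3 x y = dot3 y x.
Proof. by rewrite /dot3; congr (_ + _ + _); apply: mulrC. Qed.

Lemma rows_mx_orthogonal x y b :
  dot3 x x = 1 -> dot3 y y = 1 -> dot3 b b = 1 ->
  dot3 x y = 0 -> dot3 x b = 0 -> dot3 y b = 0 ->
  orthogonal_mx (rows_mx x y b).
Proof.
move=> xx yy bb xy xb yb; apply: mulmx1C; apply/matrixP.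
have entry (v w : R * R * R) : v.1.1 * w.1.1 + v.1.2 * w.1.2 + v.2 * w.2 =
  dot3 v w by [].
by elim/ord3_ind; elim/ord3_ind;
  rewrite !mxE !big_ord3 !mxE !(tnth_nth 0) /= entry // dot3C.
Qed.

(** Two nonzero orthogonal vectors determine a frame with rows along [x],
    [b x x] and [b]; its coordinates are positive multiples of the products
    with these vectors, so signs can be checked without normalizing. *)
Lemma frame_of_orthogonal x b :
  dot3 x b = 0 -> 0 < dot3 x x -> 0 < dot3 b b ->
  let nx := Num.sqrt (dot3 x x) in let nb := Num.sqrt (dot3 b b) in
  exists2 P : 'M[R]_3, orthogonal_mx P &
    forall w, coords (P *m w) =
      (dot3 x (coords w) / nx, dot3 (cross3 b x) (coords w) / (nx * nb),
       dot3 b (coords w) / nb).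
Proof.
move=> xb xx bb nx nb.
have nx0 : nx != 0 by rewrite gt_eqF // sqrtr_gt0.
have nb0 : nb != 0 by rewrite gt_eqF // sqrtr_gt0.
have nxE : nx ^+ 2 = dot3 x x by rewrite sqr_sqrtr // ltW.
have nbE : nb ^+ 2 = dot3 b b by rewrite sqr_sqrtr // ltW.
pose sc (c : R) v : R * R * R := (v.1.1 / c, v.1.2 / c, v.2 / c).
have dsc c v w : dot3 (sc c v) w = dot3 v w / c.
  by rewrite /dot3 /sc /= !mulrDl; congr (_ + _ + _); rewrite mulrAC.
have dscr c v w : dot3 w (sc c v) = dot3 w v / c.
  by rewrite /dot3 /sc /= !mulrDl !mulrA.
exists (rows_mx (sc nx x) (sc (nx * nb) (cross3 b x)) (sc nb b)); last first.
  by move=> w; rewrite rows_mxM !dsc.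
(* Lagrange's identity, the scalar product of [b] and [x] being zero. *)
have cc : dot3 (cross3 b x) (cross3 b x) = (nx * nb) ^+ 2.
  rewrite exprMn nxE nbE; move: xb; rewrite /dot3 /cross3 /= => xb.
  by move: (congr1 (fun z => z ^+ 2) xb); rewrite expr0n /=; lra.
have xc : dot3 x (cross3 b x) = 0 by rewrite /dot3 /cross3 /=; ring.
have cb : dot3 (cross3 b x) b = 0 by rewrite /dot3 /cross3 /=; ring.
apply: rows_mx_orthogonal; rewrite dsc dscr ?xb ?xc ?cb ?mul0r // ?cc -?nxE -?nbE;
  by field; rewrite ?nx0 ?nb0.
Qed.

(** * Continuity of polynomial expressions *)

(** A constant of its own, since [continuous] unfolds to a quantified statement
    on which the syntactic matching of [continuity] below does not work. *)
Definition cont (T : topologicalType) (f : T -> R) : Prop := continuous f.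

Lemma near_pos (f : R -> R) :
  cont f -> 0 < f 0 -> \forall t \near (0 : R), 0 < f t.
Proof. by move=> cf f0; exact: (cvgr_gt (f 0) (cf 0)). Qed.

Section Continuity.
Variable T : topologicalType.
Implicit Types f g : T -> R.

Lemma cont_cst (c : R) : cont (fun _ : T => c).
Proof. by move=> t; apply: cvg_cst. Qed.

Lemma contD f g : cont f -> cont g ->
  cont (fun t => f t + g t).
Proof. by move=> cf cg t; apply: (cvgD (cf t) (cg t)). Qed.

Lemma contN f : cont f -> cont (fun t => - f t).
Proof. by move=> cf t; apply: (cvgN (cf t)). Qed.

Lemma contM f g : cont f -> cont g ->
  cont (fun t => f t * g t).
Proof. by move=> cf cg t; apply: (cvgM (cf t) (cg t)). Qed.

Lemma closed_forall (I : Type) (A : I -> set T) :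
  (forall i, closed (A i)) -> closed [set e | forall i, A i e].
Proof.
move=> clA; rewrite (_ : mkset _ = \bigcap_(i in setT) A i).
  by apply: closed_bigI => i _; apply: clA.
by rewrite predeqE => e; split => [Ae i _|Ae i]; apply: Ae.
Qed.

Lemma closed_cont_ge0 f :
  cont f -> closed [set e | 0 <= f e].
Proof.
move=> cf; apply: (@preimage_closed T R f [set y | 0 <= y]).
  by move=> e _; apply: cf.
exact: closed_ge.
Qed.

Lemma closed_cont_eq f (c : R) :
  cont f -> closed [set e | f e = c].
Proof.
move=> cf; apply: (@preimage_closed T R f [set y | y = c]).
  by move=> e _; apply: cf.
exact: closed_eq.
Qed.

End Continuity.

Lemma cont_id : cont (fun t : R => t).
Proof. by move=> t; apply: cvg_id. Qed.

Ltac continuity := cbn beta iota delta [fst snd];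
  lazymatch goal with
  | |- cont (fun t => t) => apply: cont_id
  | |- cont (fun t => @?f t + @?g t) =>
      apply: (@contD _ f g); continuity
  | |- cont (fun t => - @?f t) => apply: (@contN _ f); continuity
  | |- cont (fun t => @?f t * @?g t) =>
      apply: (@contM _ f g); continuity
  | _ => apply: cont_cst
  end.

(** A property near 0 holds at two opposite points; the improving direction
    of the frame is later known only up to sign. *)
Lemma small_step (P : set R) : (\forall t \near (0 : R), P t) ->
  exists2 h, 0 < h & P h /\ P (- h).
Proof.
case/nbhs_ballP => e /= e0 ball_e; exists (e / 2); first by rewrite divr_gt0.
have he : `|e / 2| < e by rewrite gtr0_norm ?divr_gt0 // ltr_pdivrMr //
  ltr_pMr // ltr1n.
by split; apply: ball_e; rewrite /ball /= sub0r normrN // normrN.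
Qed.

(** * Moving the frame *)

(** While a frame turns, the coordinates [f m] decrease at the rates [h m];
    the smallest ratio gives the first moment at which one of them vanishes. *)
Lemma first_zero (I : finType) (f h : I -> R) (k l : I) : l != k ->
  (forall m, 0 <= f m) -> (forall m, m != k -> 0 < h m) ->
  exists t n, [/\ 0 <= t, n != k, f n - t * h n = 0 &
    forall m, m != k -> 0 <= f m - t * h m].
Proof.
move=> lk f0 h0.
case: (@Order.TotalTheory.arg_minP _ _ _ l (fun m => m != k)
  (fun m => f m / h m) lk) => n nk min_n.
exists (f n / h n), n; split => //; first by rewrite divr_ge0 // ltW // h0.
  by rewrite divfK ?subrr // gt_eqF // h0.
by move=> m mk; rewrite subr_ge0 -ler_pdivlMr ?h0 // min_n.
Qed.

(** In this section [v m] holds the coordinates of the vector of index [m] in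
    the current frame.  The projections along the first axis span the angle
    [0 <= Z], [tau Z <= Y], whose sides carry only [v i] and [v j]. *)
Section Tilt.
Variables (I : finType) (v : I -> R * R * R) (tau : R) (i j : I).
Hypotheses (tau0 : 0 <= tau) (neq_ij : i != j).
Hypothesis (X0 : forall m, 0 <= (v m).1.1).
Hypothesis (Zi : (v i).2 = 0) (Zpos : forall m, m != i -> 0 < (v m).2).
Hypothesis (Yj : (v j).1.2 = tau * (v j).2).
Hypothesis (Ypos : forall m, m != j -> tau * (v m).2 < (v m).1.2).

(** The second-order improvement: the axis moves to [x t = (1, t d2, t d3)], the
    third vector [b t] stays orthogonal to [v i], so that [v i] remains on its
    side.  Then [F m t] compares the sides of the angle with [v m], where
    [1 + t^2 D / 2] bounds the length of [x t] from above.  All [F m] with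
    [m != j] are positive at 0, whereas [F j 0 = 0] and [F j t + F j (- t)] is
    [2 t^2] times the quantity assumed positive. *)
Lemma tilt (d2 d3 : R) :
  (forall m, (v m).1.1 = 0 -> d2 * (v m).1.2 + d3 * (v m).2 = 0) ->
  let p := (v i).1.1 in let s := (v i).1.2 in
  let q := (v j).1.1 in let g := (v j).2 in
  let D := d2 ^+ 2 + d3 ^+ 2 in
  0 < D * p * q + tau * s * g * D / 2 - d2 * s * g * (tau * d2 + d3) ->
  exists x b, [/\ dot3 x b = 0, 0 < dot3 x x, 0 < dot3 b b &
    forall m, [/\ 0 <= dot3 x (v m), 0 <= dot3 b (v m) &
      tau * Num.sqrt (dot3 x x) * dot3 b (v m) < dot3 (cross3 b x) (v m)]].
Proof.
move=> dX p s q g D E.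
have D0 : 0 <= D by rewrite addr_ge0 ?sqr_ge0.
have s0 : 0 < s by have := Ypos neq_ij; rewrite Zi mulr0.
have g0 : 0 < g by apply: Zpos; rewrite eq_sym.
pose x t : R * R * R := (1, t * d2, t * d3).
pose b t : R * R * R := cross3 (x t) (v i).
pose a t := cross3 (b t) (x t).
pose F m t := dot3 (a t) (v m) - tau * (1 + t * t * (D / 2)) * dot3 (b t) (v m).
pose ok m t := [/\ (v m).1.1 = 0 \/ 0 < dot3 (x t) (v m),
  m = i \/ 0 < dot3 (b t) (v m) & m = j \/ 0 < F m t].
have near_ok : \forall t \near (0 : R), 0 < (b t).2 /\ forall m : I, ok m t.
  apply: filterI.
    apply: (@near_pos (fun t => (b t).2)); first by rewrite /b /x /cross3; continuity.
    by rewrite /= !mul0r subr0 mul1r.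
  apply: (@filter_forall _ _ ok (nbhs (0 : R))) => m; near=> t; split; near: t.
  - have [->|m0] := eqVneq (v m).1.1 0; first by apply: nearW; left.
    suff : \forall t \near (0 : R), 0 < dot3 (x t) (v m).
      by apply: filterS => t; right.
    apply: (@near_pos (fun t => dot3 (x t) (v m))); first by rewrite /dot3 /x; continuity.
    by rewrite /dot3 /= !mul0r mul1r !addr0 lt_def m0 X0.
  - have [->|mi] := eqVneq m i; first by apply: nearW; left.
    suff : \forall t \near (0 : R), 0 < dot3 (b t) (v m).
      by apply: filterS => t; right.
    apply: (@near_pos (fun t => dot3 (b t) (v m))); first by rewrite /dot3 /b /x /cross3; continuity.
    have -> : dot3 (b 0) (v m) = s * (v m).2.
      by rewrite /dot3 /b /cross3 /= Zi -/s; ring.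
    by rewrite mulr_gt0 ?Zpos.
  - have [->|mj] := eqVneq m j; first by apply: nearW; left.
    suff : \forall t \near (0 : R), 0 < F m t.
      by apply: filterS => t; right.
    apply: (@near_pos (F m)); first by rewrite /F /dot3 /a /b /x /cross3; continuity.
    rewrite /F /dot3 /a /b /cross3 /= Zi.
    have := mulr_gt0 s0 (etrans (subr_gt0 _ _) (Ypos mj)); rewrite -/s.
    by congr (_ < _); ring.
have [h h0 [okh okNh]] := small_step near_ok.
have sumF : 0 < F j h + F j (- h).
  have := mulr_gt0 (mulr_gt0 h0 h0) (mulr_gt0 (ltr0Sn R 1) E).
  rewrite /F /dot3 /a /b /cross3 /= Zi Yj /D -/p -/s -/q -/g.
  by congr (_ < _); field.
have [t [bt0 okt] Fjt] : exists2 t, 0 < (b t).2 /\ (forall m, ok m t) & 0 < F j t.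
  by case: (ltP 0 (F j h)) => Fh; [exists h|exists (- h) => //; lra].
exists (x t), (b t).
have xxE : dot3 (x t) (x t) = 1 + t * t * D by rewrite /dot3 /x /= /D; ring.
have tD0 : 0 <= t * t * D by rewrite mulr_ge0 // -expr2 sqr_ge0.
have bv0 m : 0 <= dot3 (b t) (v m).
  have [_ [->|/ltW//] _] := okt m.
  suff -> : dot3 (b t) (v i) = 0 by [].
  by rewrite /dot3 /b /cross3 /=; ring.
split.
- by rewrite /dot3 /b /cross3 /=; ring.
- by rewrite xxE; lra.
- have : 0 < (b t).2 ^+ 2 by rewrite exprn_gt0.
  have := sqr_ge0 (b t).1.1; have := sqr_ge0 (b t).1.2; rewrite /dot3; nra.
move=> m; split => //.
  have [[X_m|/ltW//] _ _] := okt m.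
  have -> : dot3 (x t) (v m) =
      (v m).1.1 + t * (d2 * (v m).1.2 + d3 * (v m).2).
    by rewrite /dot3 /=; ring.
  by rewrite X_m dX // mulr0 addr0.
have Fm : 0 < F m t by have [_ _ [->|]] := okt m.
move: Fm; rewrite /F subr_gt0; apply: le_lt_trans.
rewrite ler_wpM2r // ler_wpM2l // xxE.
(* [sqrt (1 + y) <= 1 + y / 2] *)
have le1 : 0 <= 1 + t * t * (D / 2) by lra.
rewrite -[leRHS]ger0_norm // -sqrtr_sqr ler_sqrt ?sqr_ge0 //.
have := sqr_ge0 (t * t * (D / 2)); lra.
Unshelve. all: by end_near.
Qed.

(** Either the angle can be made strictly smaller, or two of the vectors can be
    brought into the plane orthogonal to the first axis.  If [v k] has a zero
    first coordinate, the axis moves in the direction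
    [d = (- Z k, Y k)] orthogonal to [v k]; since [v k] lies between the two
    sides, [<d, v i>] and [<d, v j>] have opposite signs, which is what [tilt]
    needs.  This gives no strict gain exactly when [tau = 0] and [v k] is [v i]
    or [v j], hence on a coordinate axis, and then a rotation about this axis
    works. *)
Lemma escape :
  (forall m n, (v m).1.1 = 0 -> (v n).1.1 = 0 -> m = n) ->
  exists x b, [/\ dot3 x b = 0, 0 < dot3 x x, 0 < dot3 b b,
    forall m, [/\ 0 <= dot3 x (v m), 0 <= dot3 (cross3 b x) (v m) &
      0 <= dot3 b (v m)] &
    (exists m n, [/\ m != n, dot3 x (v m) = 0 & dot3 x (v n) = 0]) \/
    forall m, tau * Num.sqrt (dot3 x x) * dot3 b (v m)
      < dot3 (cross3 b x) (v m)].
Proof.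
move=> uniqX; set goal := (ex _).
have Z0 m : 0 <= (v m).2.
  by have [->|/Zpos/ltW//] := eqVneq m i; rewrite Zi.
have Y0 m : 0 <= (v m).1.2.
  have tZ : 0 <= tau * (v m).2 by rewrite mulr_ge0.
  by have [->|/Ypos/ltW] := eqVneq m j; [rewrite Yj mulr_ge0|apply: le_trans].
have s0 : 0 < (v i).1.2 by have := Ypos neq_ij; rewrite Zi mulr0.
have neq_ji : j != i by rewrite eq_sym.
have g0 : 0 < (v j).2 by apply: Zpos.
have of_tilt d2 d3 :
  (forall m, (v m).1.1 = 0 -> d2 * (v m).1.2 + d3 * (v m).2 = 0) ->
  0 < (d2 ^+ 2 + d3 ^+ 2) * (v i).1.1 * (v j).1.1
    + tau * (v i).1.2 * (v j).2 * (d2 ^+ 2 + d3 ^+ 2) / 2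
    - d2 * (v i).1.2 * (v j).2 * (tau * d2 + d3) ->
  goal.
  move=> dX E; have [x [b [xb xx bb H]]] := tilt dX E.
  exists x, b; split => // [m|]; last by right=> m; case: (H m).
  have [Hx Hb Ha] := H m; split=> //; apply: le_trans (ltW Ha).
  by rewrite !mulr_ge0 // sqrtr_ge0.
have [[k Xk]|noX] := pselect (exists k, (v k).1.1 = 0); last first.
  have Xpos m : 0 < (v m).1.1.
    by rewrite lt_def X0 andbT; apply/eqP => Xm; apply: noX; exists m.
  apply: (of_tilt 0 1) => [m Xm|]; first by have := Xpos m; rewrite Xm ltxx.
  rewrite expr0n expr1n /= add0r !mulr1 !mul0r subr0 mul1r.
  by rewrite ltr_wpDr ?mulr_gt0 // divr_ge0 // !mulr_ge0 // ltW.
have Xpos m : m != k -> 0 < (v m).1.1.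
  move=> mk; rewrite lt_def X0 andbT; apply: contra_neq mk => Xm.
  exact: uniqX.
have YZk : 0 < (v k).1.2 ^+ 2 + (v k).2 ^+ 2.
  have [ki|ki] := eqVneq k i.
    by rewrite ltr_pwDl ?sqr_ge0 // ki exprn_gt0.
  by rewrite ltr_wpDl ?sqr_ge0 // exprn_gt0 // Zpos.
(* In the second and third cases only one coordinate of [v k] is nonzero. *)
have tau_or : [\/ 0 < tau, tau = 0 /\ k = i, tau = 0 /\ k = j |
    [/\ tau = 0, k != i & k != j]].
  have [->|t0] := eqVneq tau 0; last by constructor 1; rewrite lt_def t0.
  have [->|ki] := eqVneq k i; first by constructor 2.
  by have [->|kj] := eqVneq k j; [constructor 3|constructor 4].
have dX m : (v m).1.1 = 0 ->
    - (v k).2 * (v m).1.2 + (v k).1.2 * (v m).2 = 0.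
  by move=> Xm; rewrite (uniqX _ _ Xm Xk); ring.
have wedge_k : 0 <= (v k).1.2 - tau * (v k).2.
  by rewrite subr_ge0; have [->|/Ypos/ltW//] := eqVneq k j; rewrite Yj.
have sg0 : 0 < (v i).1.2 * (v j).2 by rewrite mulr_gt0.
have pq0 : 0 <= (v i).1.1 * (v j).1.1 by rewrite mulr_ge0.
have tiltE : 0 < tau \/ 0 < (v k).2 * ((v k).1.2 - tau * (v k).2) ->
    0 < ((- (v k).2) ^+ 2 + (v k).1.2 ^+ 2) * (v i).1.1 * (v j).1.1
    + tau * (v i).1.2 * (v j).2 * ((- (v k).2) ^+ 2 + (v k).1.2 ^+ 2) / 2
    - (- (v k).2) * (v i).1.2 * (v j).2 * (tau * (- (v k).2) + (v k).1.2).
  have [Zk Yk] := (Z0 k, Y0 k).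
  set D := _ + (v k).1.2 ^+ 2.
  have D0 : 0 < D by rewrite /D sqrrN addrC.
  have -> : D * (v i).1.1 * (v j).1.1 + tau * (v i).1.2 * (v j).2 * D / 2
      - (- (v k).2) * (v i).1.2 * (v j).2 * (tau * (- (v k).2) + (v k).1.2) =
      D * ((v i).1.1 * (v j).1.1) + (v i).1.2 * (v j).2 *
      (tau * D / 2 + (v k).2 * ((v k).1.2 - tau * (v k).2)) by field.
  move=> pos; apply: ltr_wpDl; first by rewrite mulr_ge0 // ltW.
  rewrite mulr_gt0 //; case: pos => pos.
    by rewrite ltr_pwDl ?mulr_ge0 // divr_gt0 // mulr_gt0.
  by rewrite ltr_wpDl // divr_ge0 // mulr_ge0 // ltW.
case: tau_or => [t0|[t0 ki]|[t0 kj]|[t0 ki kj]].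
- by apply: of_tilt dX _; apply: tiltE; left.
(* Turn about the second axis, on which [v i] lies. *)
- have [t [n [t_ge0 ni nz pos]]] :=
    first_zero neq_ji X0 (fun m mi => Zpos mi).
  have xv m : dot3 (1, 0, - t) (v m) = (v m).1.1 - t * (v m).2.
    by rewrite /dot3 /=; ring.
  have xi : dot3 (1, 0, - t) (v i) = 0 by rewrite xv Zi -ki Xk; ring.
  exists (1, 0, - t), (t, 0, 1); split.
  + by rewrite /dot3 /=; ring.
  + by rewrite /dot3 /=; have := sqr_ge0 t; nra.
  + by rewrite /dot3 /=; have := sqr_ge0 t; nra.
  + move=> m; split.
    * by have [->|mi] := eqVneq m i; [rewrite xi|rewrite xv pos].
    * have -> : dot3 (cross3 (t, 0, 1) (1, 0, - t)) (v m) =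
          (1 + t ^+ 2) * (v m).1.2 by rewrite /dot3 /cross3 /=; ring.
      by rewrite mulr_ge0 // addr_ge0 // sqr_ge0.
    * by rewrite /dot3 /= mul0r addr0 mul1r addr_ge0 // mulr_ge0.
  + by left; exists n, i; rewrite xv.
(* Turn about the third axis, on which [v j] lies. *)
- have Yp m : m != j -> 0 < (v m).1.2 by move/Ypos; rewrite t0 mul0r.
  have [t [n [t_ge0 nj nz pos]]] := first_zero neq_ij X0 Yp.
  have xv m : dot3 (1, - t, 0) (v m) = (v m).1.1 - t * (v m).1.2.
    by rewrite /dot3 /=; ring.
  have xj : dot3 (1, - t, 0) (v j) = 0 by rewrite xv Yj t0 -kj Xk; ring.
  exists (1, - t, 0), (0, 0, 1); split.
  + by rewrite /dot3 /=; ring.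
  + by rewrite /dot3 /=; have := sqr_ge0 t; nra.
  + by rewrite /dot3 /=; lra.
  + move=> m; split.
    * by have [->|mj] := eqVneq m j; [rewrite xj|rewrite xv pos].
    * have -> : dot3 (cross3 (0, 0, 1) (1, - t, 0)) (v m) =
          t * (v m).1.1 + (v m).1.2 by rewrite /dot3 /cross3 /=; ring.
      by rewrite addr_ge0 // mulr_ge0.
    * by rewrite /dot3 /= !mul0r !add0r mul1r.
  + by left; exists n, j; rewrite xv.
- apply: of_tilt dX _; apply: tiltE; right.
  rewrite mulr_gt0 ?Zpos // subr_gt0; exact: Ypos.
Qed.

End Tilt.


(** * Frames with the smallest apparent angle *)

Section Frames.
Variables (p : nat) (u : 'I_p -> 'cV[R]_3).

(** All coordinates are nonnegative, and the projections along the first axis lie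
    in the angle with cotangent [mu / (1 - mu)].  This parameter, unlike the
    cotangent, ranges over a compact interval; at [mu = 1] the angle is zero. *)
Definition in_wedge (mu : R) (Q : 'M[R]_3) : Prop :=
  forall m, (forall k, 0 <= (Q *m u m) k ord0) /\
    mu * (Q *m u m) iz ord0 <= (1 - mu) * (Q *m u m) iy ord0.

Definition two_on_a_face : Prop :=
  exists Q : 'M[R]_3, [/\ orthogonal_mx Q,
    forall m k, 0 <= (Q *m u m) k ord0 &
    exists i j k, [/\ i != j, (Q *m u i) k ord0 = 0 & (Q *m u j) k ord0 = 0]].

Lemma two_on_a_face_of_flag (Q : 'M[R]_3) x b : orthogonal_mx Q ->
  dot3 x b = 0 -> 0 < dot3 x x -> 0 < dot3 b b ->
  (forall m, [/\ 0 <= dot3 x (coords (Q *m u m)),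
    0 <= dot3 (cross3 b x) (coords (Q *m u m)) &
    0 <= dot3 b (coords (Q *m u m))]) ->
  (exists m n, [/\ m != n, dot3 x (coords (Q *m u m)) = 0 &
    dot3 x (coords (Q *m u n)) = 0]) ->
  two_on_a_face.
Proof.
move=> QQ xb xx bb nonneg [i [j [ij xi xj]]].
have [P PP PE] := frame_of_orthogonal xb xx bb.
exists (P *m Q); split; first exact: orthogonal_mxM.
  move=> m; rewrite -mulmxA; have [Hx Ha Hb] := nonneg m.
  case: (PE (Q *m u m)) => EX EY EZ.
  by elim/ord3_ind; rewrite ?EX ?EY ?EZ divr_ge0 // ?mulr_ge0 // sqrtr_ge0.
exists i, j, ix; rewrite -!mulmxA; split => //.
  by case: (PE (Q *m u i)) => ->; rewrite xi mul0r.
by case: (PE (Q *m u j)) => ->; rewrite xj mul0r.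
Qed.

Section Maximal.
Variables (mu : R) (Q : 'M[R]_3).
Hypotheses (mu0 : 0 <= mu) (mu1 : mu < 1) (QQ : orthogonal_mx Q).
Hypothesis wQ : in_wedge mu Q.
Hypothesis maxQ : forall mu' Q', 0 <= mu' <= 1 -> orthogonal_mx Q' ->
  in_wedge mu' Q' -> mu' <= mu.
Let tau := mu / (1 - mu).
Let v m := coords (Q *m u m).

(** A frame in which every vector is strictly inside the side [Y = tau Z], or on
    the opposite side [Z = 0], would allow a slightly larger [mu].  The frame is
    given by orthogonal vectors that need not be unit, whence the factor
    [Num.sqrt (dot3 x x)]: it is the length of [cross3 b x] relative to [b]. *)
Lemma no_better_frame x b :
  dot3 x b = 0 -> 0 < dot3 x x -> 0 < dot3 b b ->
  (forall m, [/\ 0 <= dot3 x (v m), 0 <= dot3 (cross3 b x) (v m) &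
    0 <= dot3 b (v m)]) ->
  ~ forall m, dot3 b (v m) = 0 \/
    tau * Num.sqrt (dot3 x x) * dot3 b (v m) < dot3 (cross3 b x) (v m).
Proof.
move=> xb xx bb nonneg better.
have [P PP PE] := frame_of_orthogonal xb xx bb.
set nx := Num.sqrt (dot3 x x) in PE better.
set nb := Num.sqrt (dot3 b b) in PE.
have nx0 : 0 < nx by rewrite sqrtr_gt0.
have nb0 : 0 < nb by rewrite sqrtr_gt0.
have mu1' : 0 < 1 - mu by rewrite subr_gt0.
pose y m := dot3 (cross3 b x) (v m) / (nx * nb).
pose z m := dot3 b (v m) / nb.
pose ok m t := (mu + t) * z m <= (1 - (mu + t)) * y m.
have near1 : \forall t \near (0 : R), 0 < 1 - (mu + t).
  apply: (@near_pos (fun t => 1 - (mu + t))); first by continuity.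
  by rewrite addr0.
have : \forall t \near (0 : R), 0 < 1 - (mu + t) /\ forall m, ok m t.
  apply: filterI => //; apply: (@filter_forall _ _ ok (nbhs (0 : R))) => m.
  have [bv|strict] := better m.
    apply: filterS near1 => t /ltW t1; rewrite /ok /z bv mul0r mulr0.
    have [_ ? _] := nonneg m.
    by rewrite mulr_ge0 // divr_ge0 // mulr_ge0 // ltW.
  suff : \forall t \near (0 : R), 0 < (1 - (mu + t)) * y m - (mu + t) * z m.
    by apply: filterS => t; rewrite subr_gt0 => /ltW.
  apply: (@near_pos (fun t => (1 - (mu + t)) * y m - (mu + t) * z m)).
    by continuity.
  rewrite addr0 subr_gt0.
  have -> : mu * z m = (1 - mu) * (tau * nx * dot3 b (v m)) / (nx * nb).
    by rewrite /z /tau; field; rewrite !gt_eqF.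
  by rewrite /y -mulrA ltr_pM2l // ltr_pM2r // invr_gt0 mulr_gt0.
case/small_step => h h0 [[h1 okh] _].
have : ~~ (mu + h <= mu) by rewrite gerDl -ltNge.
case/negP; apply: (maxQ (Q' := P *m Q)).
- by rewrite addr_ge0 ?(ltW h0) //= -subr_ge0 ltW.
- exact: orthogonal_mxM.
move=> m; rewrite -mulmxA; have [Hx Ha Hb] := nonneg m.
case: (PE (Q *m u m)) => EX EY EZ; split; last by rewrite EY EZ; apply: okh.
by elim/ord3_ind; rewrite ?EX ?EY ?EZ divr_ge0 // ?mulr_ge0 // sqrtr_ge0.
Qed.

(** Assuming that no frame is as wanted, maximality forces each side of the
    angle to carry exactly one vector: two vectors would share a zero with
    respect to the normal of the side, and if one side is free, the angle can
    be turned or narrowed.  Then [escape] applies. *)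
Lemma two_on_a_face_of_maximal : two_on_a_face.
Proof.
have mu1' : 0 < 1 - mu by rewrite subr_gt0.
have tau0 : 0 <= tau by rewrite divr_ge0 // ltW.
have X0 m : 0 <= (v m).1.1 by have [/(_ ix)] := wQ m.
have Y0 m : 0 <= (v m).1.2 by have [/(_ iy)] := wQ m.
have Z0 m : 0 <= (v m).2 by have [/(_ iz)] := wQ m.
have wall m : tau * (v m).2 <= (v m).1.2.
  have [_ wm] := wQ m.
  by rewrite /tau mulrAC ler_pdivrMr // [leRHS]mulrC.
have Q0 m k : 0 <= (Q *m u m) k ord0 by have [] := wQ m.
apply: contrapT => not_face.
have uniqX m n : (v m).1.1 = 0 -> (v n).1.1 = 0 -> m = n.
  move=> Xm Xn; apply: contrapT => /eqP mn; apply: not_face.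
  by exists Q; split => //; exists m, n, ix.
have uniqZ m n : (v m).2 = 0 -> (v n).2 = 0 -> m = n.
  move=> Zm Zn; apply: contrapT => /eqP mn; apply: not_face.
  by exists Q; split => //; exists m, n, iz.
have uniqW m n : (v m).1.2 = tau * (v m).2 -> (v n).1.2 = tau * (v n).2 ->
    m = n.
  move=> Wm Wn; apply: contrapT => /eqP mn; apply: not_face.
  (* The normal of the side [Y = tau Z] becomes the first row of the frame. *)
  have xv k : dot3 (0, 1, - tau) (v k) = (v k).1.2 - tau * (v k).2.
    by rewrite /dot3 /=; ring.
  apply: (two_on_a_face_of_flag (x := (0, 1, - tau)) (b := (1, 0, 0)) QQ).
  - by rewrite /dot3 /=; ring.
  - by rewrite /dot3 /=; have := sqr_ge0 tau; nra.
  - by rewrite /dot3 /=; lra.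
  - move=> k; rewrite -/(v k) xv subr_ge0 wall; split => //.
      have -> : dot3 (cross3 (1, 0, 0) (0, 1, - tau)) (v k) =
        tau * (v k).1.2 + (v k).2 by rewrite /dot3 /cross3 /=; ring.
      by rewrite addr_ge0 // mulr_ge0.
    by rewrite /dot3 /= !mul0r !addr0 mul1r.
  - by exists m, n; rewrite -/(v m) -/(v n) !xv Wm Wn !subrr.
have [i Zi] : exists i, (v i).2 = 0.
  apply: contrapT => noZ.
  (* Turn the second and third axes about the first by a small angle. *)
  have Zpos m : 0 < (v m).2.
    by rewrite lt_def Z0 andbT; apply/eqP => Zm; apply: noZ; exists m.
  pose ok m t := 0 < (v m).2 - t * (v m).1.2.
  have : \forall t \near (0 : R), forall m, ok m t.
    apply: (@filter_forall _ _ ok (nbhs (0 : R))) => m.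
    apply: (@near_pos (fun t => (v m).2 - t * (v m).1.2)); first by continuity.
    by rewrite mul0r subr0.
  case/small_step => h h0 [okh _].
  have xE m : dot3 (1, 0, 0) (v m) = (v m).1.1 by rewrite /dot3 /=; ring.
  have bE m : dot3 (0, - h, 1) (v m) = (v m).2 - h * (v m).1.2.
    by rewrite /dot3 /=; ring.
  have aE m : dot3 (cross3 (0, - h, 1) (1, 0, 0)) (v m) =
      (v m).1.2 + h * (v m).2 by rewrite /dot3 /cross3 /=; ring.
  apply: (no_better_frame (x := (1, 0, 0)) (b := (0, - h, 1))).
  - by rewrite /dot3 /=; ring.
  - by rewrite /dot3 /=; lra.
  - by rewrite /dot3 /=; have := sqr_ge0 h; nra.
  - move=> m; rewrite xE bE aE; split => //; last exact: ltW (okh m).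
    by rewrite addr_ge0 // mulr_ge0 // ltW.
  - move=> m; right; rewrite bE aE.
    have -> : dot3 (1, 0, 0) (1, 0, 0) = 1
      by rewrite /dot3 /= mulr1 !mulr0 !addr0.
    rewrite sqrtr1 mulr1 mulrBr.
    have : 0 < h * (v m).2 by rewrite mulr_gt0.
    have : 0 <= tau * (h * (v m).1.2) by rewrite mulr_ge0 // mulr_ge0 // ltW.
    by have := wall m; lra.
have [j Yj Zj] : exists2 j, (v j).1.2 = tau * (v j).2 & (v j).2 != 0.
  apply: contrapT => noW.
  have xE m : dot3 (1, 0, 0) (v m) = (v m).1.1 by rewrite /dot3 /=; ring.
  have bE m : dot3 (0, 0, 1) (v m) = (v m).2 by rewrite /dot3 /=; ring.
  have aE m : dot3 (cross3 (0, 0, 1) (1, 0, 0)) (v m) = (v m).1.2.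
    by rewrite /dot3 /cross3 /=; ring.
  apply: (no_better_frame (x := (1, 0, 0)) (b := (0, 0, 1))).
  - by rewrite /dot3 /=; ring.
  - by rewrite /dot3 /=; lra.
  - by rewrite /dot3 /=; lra.
  - by move=> m; rewrite xE bE aE.
  - move=> m; rewrite bE aE; have [|Zm] := eqVneq (v m).2 0; [by left|right].
    have -> : dot3 (1, 0, 0) (1, 0, 0) = 1
      by rewrite /dot3 /= mulr1 !mulr0 !addr0.
    rewrite sqrtr1 mulr1 lt_def wall andbT; apply/eqP => Ym.
    by apply: noW; exists m.
have ij : i != j by apply: contra_neq Zj => <-.
have Zpos m : m != i -> 0 < (v m).2.
  by move=> mi; rewrite lt_def Z0 andbT; apply: contra_neq mi => Zm; apply: uniqZ.
have Ypos m : m != j -> tau * (v m).2 < (v m).1.2.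
  by move=> mj; rewrite lt_def wall andbT; apply: contra_neq mj => Ym; apply: uniqW.
have [x [b [xb xx bb nonneg]]] := escape tau0 ij X0 Zi Zpos Yj Ypos uniqX.
case=> [two|better].
  by apply: not_face; apply: two_on_a_face_of_flag QQ xb xx bb nonneg two.
by apply: (no_better_frame xb xx bb nonneg) => m; right.
Qed.

End Maximal.
(** The entries of an orthogonal matrix lie in [[-1, 1]], so the admissible pairs
    ([Q], [mu]) form a closed subset of a box, [Q] being flattened to a row. *)
Lemma exists_maximal_frame (Q0 : 'M[R]_3) : orthogonal_mx Q0 ->
  (forall m k, 0 <= (Q0 *m u m) k ord0) ->
  exists mu Q, [/\ 0 <= mu <= 1, orthogonal_mx Q, in_wedge mu Q &
    forall mu' Q', 0 <= mu' <= 1 -> orthogonal_mx Q' -> in_wedge mu' Q' ->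
      mu' <= mu].
Proof.
move=> Q0Q0 nonneg0.
pose E : topologicalType := ('rV[R]_(3 * 3) * R)%type.
pose en (i j : 'I_3) (e : E) : R := e.1 ord0 (mxvec_index i j).
pose mx (e : E) : 'M[R]_3 := vec_mx e.1.
pose co m k (e : E) : R := en k ix e * u m ix ord0 + en k iy e * u m iy ord0
   + en k iz e * u m iz ord0.
pose gram i j (e : E) : R :=
  en ix i e * en ix j e + en iy i e * en iy j e + en iz i e * en iz j e.
have coE m k e : (mx e *m u m) k ord0 = co m k e.
  by rewrite !mxE big_ord3 !mxE.
have gramE i j e : ((mx e)^T *m mx e) i j = gram i j e.
  by rewrite !mxE big_ord3 !mxE.
pose K := [set e : E | 0 <= e.2] `&` [set e : E | 0 <= 1 - e.2]
  `&` [set e : E | forall i j, gram i j e = (i == j)%:R]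
  `&` [set e : E | forall m k, 0 <= co m k e]
  `&` [set e : E | forall m, 0 <= (1 - e.2) * co m iy e - e.2 * co m iz e].
have KP e : K e <-> [/\ 0 <= e.2 <= 1, orthogonal_mx (mx e) & in_wedge e.2 (mx e)].
  split.
    case=> [[[[e0 e1] ge] ce] we]; split.
    - by rewrite e0 -subr_ge0.
    - by apply/matrixP => i j; rewrite gramE ge mxE.
    - move=> m; split => [k|]; first by rewrite coE; apply: ce.
      by rewrite !coE -subr_ge0; apply: we.
  case=> /andP[e0 e1] oe we; split; [split; [split; [split|]|]|] => /=.
  - exact: e0.
  - by rewrite subr_ge0.
  - by move=> i j; rewrite -gramE oe mxE.
  - by move=> m k; rewrite -coE; have [] := we m.
  - by move=> m; rewrite -!coE subr_ge0; have [] := we m.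
have cen i j : cont (en i j).
  move=> e; apply: (@continuous_comp _ _ _ fst (fun r : 'rV[R]_(3 * 3) =>
    r ord0 (mxvec_index i j))); [exact: cvg_fst|exact: coord_continuous].
have cmu : cont (fun e : E => e.2) by move=> e; apply: cvg_snd.
have cco m k : cont (co m k).
  by rewrite /co; do !apply: contD; apply: contM => //; apply: cont_cst.
have cgram i j : cont (gram i j).
  by rewrite /gram; do !apply: contD; apply: contM.
have c1mu : cont (fun e : E => 1 - e.2).
  by apply: contD; [apply: cont_cst|apply: contN].
have Kclosed : closed K.
  apply: closedI; last first.
    apply: closed_forall => m; apply: closed_cont_ge0.
    by apply: contD; [apply: contM|apply: contN; apply: contM].
  apply: closedI; last first.
    by do 2!apply: closed_forall => ?; apply: closed_cont_ge0.
  apply: closedI; last first.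
    by do 2!apply: closed_forall => ?; apply: closed_cont_eq.
  by apply: closedI; apply: closed_cont_ge0.
have Kcompact : compact K.
  pose box : set E := [set r : 'rV[R]_(3 * 3) | forall i, `[-1, 1]%classic (r ord0 i)]
    `*` `[0, 1]%classic.
  apply: (@subclosed_compact _ _ box Kclosed).
    apply: compact_setX; last exact: segment_compact.
    apply: (@rV_compact R _ (fun=> `[-1, 1]%classic)) => _.
    exact: segment_compact.
  move=> e /KP[e01 oe _]; split; last by rewrite /= in_itv.
  move=> l /=; case/mxvec_indexP: l => i j; rewrite in_itv /= -ler_norml.
  have := gramE j j e; rewrite oe mxE eqxx /gram /= => en1.
  rewrite -(ler_pXn2r (n := 2)) ?nnegrE // expr1n real_normK ?num_real //.
  rewrite -/(en i j e).
  have [] : [/\ 0 <= en ix j e ^+ 2, 0 <= en iy j e ^+ 2 & 0 <= en iz j e ^+ 2].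
    by rewrite !sqr_ge0.
  by elim/ord3_ind: i; lra.
have K0 : K !=set0.
  exists (mxvec Q0, 0); apply/KP; rewrite /mx /= mxvecK; split => //.
    by rewrite lexx ler01.
  by move=> m; rewrite mul0r subr0 mul1r.
have [e Ke max_e] : exists2 e, e \in K & forall e', e' \in K -> e'.2 <= e.2.
  apply: (@compact_EVT_max E R snd) => //.
  by apply: continuous_subspaceT.
move: Ke; rewrite inE => /KP[e01 oe we].
exists e.2, (mx e); split => // mu' Q' mu'01 QQ' wQ'.
apply: (max_e (mxvec Q', mu')); rewrite inE; apply/KP.
by rewrite /mx /= mxvecK.
Qed.

(** The value [mu = 1] is left: there all vectors lie in the plane [Z = 0], so any
    two of them will do. *)
Lemma two_on_a_face_of_nonneg (Q0 : 'M[R]_3) : (1 < p)%N -> orthogonal_mx Q0 ->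
  (forall m k, 0 <= (Q0 *m u m) k ord0) -> two_on_a_face.
Proof.
move=> p1 Q0Q0 nonneg0.
have [mu [Q [/andP[mu0 mu1] QQ wQ maxQ]]] := exists_maximal_frame Q0Q0 nonneg0.
have [muE|mu_neq1] := eqVneq mu 1; last first.
  by apply: (@two_on_a_face_of_maximal mu Q); rewrite // lt_def eq_sym mu_neq1.
have Z0 m : (Q *m u m) iz ord0 = 0.
  have [/(_ iz) z0] := wQ m; rewrite muE subrr mul0r mul1r => z1.
  by apply/eqP; rewrite eq_le z0 z1.
exists Q; split => // [m k|]; first by have [] := wQ m.
exists (Ordinal (ltnW p1)), (Ordinal p1), iz; split; rewrite ?Z0 //.
Qed.

End Frames.

End Space.

Theorem corollary3p6 (R : realType) (p : nat) (hp : (2 <= p)%N)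
    (u : 'I_p -> 'cV[R]_3) (hu : pairwise_lin_indep u) :
  isometrically_embeddable (range u) <->
  exists Q : 'M[R]_3, embeds_by Q (range u) /\
    exists (i j : 'I_p) (k : 'I_3),
      i != j /\ (Q *m u i) k ord0 = 0 /\ (Q *m u j) k ord0 = 0.
Proof.
split=> [[Q [QQ Qu]]|[Q [Qu _]]]; last by exists Q.
have nonneg m k : 0 <= (Q *m u m) k ord0.
  by apply: Qu; exists (u m) => //; exists m.
have [Q' [QQ' nonneg' [i [j [k [ij Hi Hj]]]]]] :=
  two_on_a_face_of_nonneg hp QQ nonneg.
exists Q'; split; last by exists i, j, k.
by split => // _ [_ [m _ <-] <-] l; apply: nonneg'.
Qed.
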